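(* Let $k$ be a positive integer. The $k$-labeled Gromov-Hausdorff distance modulo relabeling, $\mathsf{GH}_{S_k}$: (1) can be expressed as $\mathsf{GH}_{S_k}(\mathcal{X},\mathcal{Y})=\min_{\sigma\in S_k}\widetilde{\mathsf{GH}}_k(\sigma\cdot\mathcal{X},\mathcal{Y})$ for all $k$-labeled metric spaces $\mathcal{X},\mathcal{Y}$; (2) defines a metric on the space of $k$-labeled metric spaces, considered up to $k$-isomorphism and the action of the symmetric group $S_k$. That is, $\mathsf{GH}_{S_k}$ is nonnegative, finite, symmetric, satisfies the triangle inequality, and $\mathsf{GH}_{S_k}(\mathcal{X},\mathcal{Y})=0$ if and only if there is $\sigma\in S_k$ such that $\sigma\cdot\mathcal{X}$ and $\mathcal{Y}$ are $k$-isomorphic.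
   Context: A $k$-labeled metric space is a triple $\mathcal{X}=(X,d_X,L_X)$, where $(X,d_X)$ is a compact metric space and $L_X=(X_1,\ldots,X_k)$ is a finite sequence of nonempty subsets $X_i\subset X$ with $X=\bigcup_{i=1}^k X_i$ (the $X_i$ may overlap). For sets $A,B$, $\mathcal{C}(A,B)$ denotes the set of correspondences, i.e. subsets $C\subset A\times B$ whose coordinate projections to $A$ and to $B$ are both surjective. For nonempty $X_1,X_2\subset X$, $Y_1,Y_2\subset Y$, $C_1\in\mathcal{C}(X_1,Y_1)$ and $C_2\in\mathcal{C}(X_2,Y_2)$, define $$\mathrm{dis}(C_1,C_2):=\sup_{(x_1,y_1)\in C_1,\ (x_2,y_2)\in C_2}|d_X(x_1,x_2)-d_Y(y_1,y_2)|.$$ For $k$-labeled metric spaces $\mathcal{X},\mathcal{Y}$, $$\mathsf{GH}_k(\mathcal{X},\mathcal{Y}):=\frac12\inf_{(C_1,\ldots,C_k)}\ \max_{i,j=1,\ldots,k}\mathrm{dis}(C_i,C_j),\qquad C_i\in\mathcal{C}(X_i,Y_i).$$ Mapping version: $$\widetilde{\mathsf{GH}}_k(\mathcal{X},\mathcal{Y}):=\frac12\inf_{\phi,\psi}\max_{i,j}\{\mathrm{dis}(\phi_i,\phi_j),\mathrm{dis}(\psi_i,\psi_j),\mathrm{codis}(\phi_i,\psi_j)\},$$ the infimum being over all sequences $\phi=(\phi_1,\ldots,\phi_k)$, $\psi=(\psi_1,\ldots,\psi_k)$ of (not necessarily continuous) maps $\phi_i:X_i\to Y_i$, $\psi_i:Y_i\to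 X_i$, where $\mathrm{dis}(\phi_i,\phi_j):=\sup_{x_i\in X_i,x_j\in X_j}|d_X(x_i,x_j)-d_Y(\phi_i(x_i),\phi_j(x_j))|$, $\mathrm{dis}(\psi_i,\psi_j):=\sup_{y_i\in Y_i,y_j\in Y_j}|d_X(\psi_i(y_i),\psi_j(y_j))-d_Y(y_i,y_j)|$, $\mathrm{codis}(\phi_i,\psi_j):=\sup_{x_i\in X_i,y_j\in Y_j}|d_X(x_i,\psi_j(y_j))-d_Y(\phi_i(x_i),y_j)|$. For $\sigma$ in the symmetric group $S_k$, $\sigma\cdot\mathcal{X}:=(X,d_X,(X_{\sigma(1)},\ldots,X_{\sigma(k)}))$, and $$\mathsf{GH}_{S_k}(\mathcal{X},\mathcal{Y}):=\min_{\sigma\in S_k}\mathsf{GH}_k(\sigma\cdot\mathcal{X},\mathcal{Y}).$$ $\mathcal{X}$ and $\mathcal{Y}$ are $k$-isomorphic if there exists an isometry (distance-preserving bijection) $\phi:X\to Y$ such that $\phi(X_i)=Y_i$ for each $i=1,\ldots,k$.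
   Formalization: The implication from distance zero to k-isomorphism up to relabeling is stated only when all labels of both spaces are closed; for arbitrary labels it fails, e.g. [0,1] labeled by ([0,1],[0,1]) versus ([0,1],[0,1)). *)

(* Defs.v *)
From HB Require Import structures.
From mathcomp Require Import all_boot all_order all_algebra fingroup perm.
From mathcomp Require Import all_classical all_reals all_analysis.

Set Implicit Arguments.
Unset Strict Implicit.
Unset Printing Implicit Defensive.

Import Order.TTheory GRing.Theory Num.Theory.
Import numFieldNormedType.Exports.

Local Open Scope classical_set_scope.
Local Open Scope ring_scope.

(* The labels are arbitrary nonempty sets: they may overlap and need not be
   closed. *)
Record klabeled (R : realType) (k : nat) := KLabeled {
  kl_space :> metricType R ;
  kl_label : 'I_k -> set kl_space ;
  kl_compact : compact [set: kl_space] ;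
  kl_nonempty : forall i, kl_label i !=set0 ;
  kl_cover : \bigcup_(i in [set: 'I_k]) kl_label i = [set: kl_space]
}.
Arguments kl_label {R k} X i _ : rename.
Arguments kl_compact {R k} X _ _ _ : rename.
Arguments kl_nonempty {R k} X i : rename.
Arguments kl_cover {R k} X : rename.

Lemma relabel_cover (R : realType) (k : nat) (s : 'S_k) (X : klabeled R k) :
  \bigcup_(i in [set: 'I_k]) kl_label X (s i) = [set: X].
Proof.
rewrite -(kl_cover X); apply/seteqP; split => x [i _ Xix].
  by exists (s i).
by exists ((s^-1)%g i) => //; rewrite permKV.
Qed.

Definition relabel (R : realType) (k : nat) (s : 'S_k) (X : klabeled R k) :
    klabeled R k :=
  {| kl_space := kl_space X ;
     kl_label := fun i => kl_label X (s i) ;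
     kl_compact := kl_compact X ;
     kl_nonempty := fun i => kl_nonempty X (s i) ;
     kl_cover := relabel_cover s X |}.

(* Correspondences do not distinguish a label from its closure: [0, 1] labeled
   by ([0, 1], [0, 1]) or by ([0, 1], [0, 1[) are at distance 0, but they are
   not isomorphic, even after relabeling.  Separation needs closed labels. *)
Definition closed_labels (R : realType) (k : nat) (X : klabeled R k) : Prop :=
  forall i, closed (kl_label X i).

Definition correspondence (S T : Type) (A : set S) (B : set T)
    (C : set (S * T)) : Prop :=
  [/\ C `<=` A `*` B, fst @` C = A & snd @` C = B].

(* Suprema and infima are taken in the extended reals, so that finiteness of
   the resulting distances is a genuine assertion. *)
Section Distortions.
Local Open Scope ereal_scope.
Variables (R : realType) (X Y : metricType R).

Definition dis_corr (C1 C2 : set (X * Y)) : \bar R :=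
  ereal_sup [set r | exists p q, [/\ C1 p, C2 q &
    r = `|mdist p.1 q.1 - mdist p.2 q.2|%:E]].

(* Maps between labels are total functions sending one label into the other;
   only their values on the label are used. *)
Definition dis_fun (A1 A2 : set X) (f1 f2 : X -> Y) : \bar R :=
  ereal_sup [set r | exists x1 x2, [/\ A1 x1, A2 x2 &
    r = `|mdist x1 x2 - mdist (f1 x1) (f2 x2)|%:E]].

Definition codis_fun (A : set X) (B : set Y) (f : X -> Y) (g : Y -> X) :
    \bar R :=
  ereal_sup [set r | exists x y, [/\ A x, B y &
    r = `|mdist x (g y) - mdist (f x) y|%:E]].

End Distortions.

Section GromovHausdorff.
Local Open Scope ereal_scope.
Variables (R : realType) (k : nat).
Implicit Types X Y : klabeled R k.

Definition GH X Y : \bar R :=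
  (2^-1)%:E * ereal_inf
    [set \big[maxe/-oo]_(i < k) \big[maxe/-oo]_(j < k) dis_corr (C i) (C j) |
      C in [set C : 'I_k -> set (X * Y) |
        forall i, correspondence (kl_label X i) (kl_label Y i) (C i)]].

Definition GH_map X Y : \bar R :=
  (2^-1)%:E * ereal_inf
    [set \big[maxe/-oo]_(i < k) \big[maxe/-oo]_(j < k)
       maxe (maxe
         (dis_fun (kl_label X i) (kl_label X j) (f.1 i) (f.1 j))
         (dis_fun (kl_label Y i) (kl_label Y j) (f.2 i) (f.2 j)))
         (codis_fun (kl_label X i) (kl_label Y j) (f.1 i) (f.2 j)) |
      f in [set f : ('I_k -> X -> Y) * ('I_k -> Y -> X) |
        forall i, set_fun (kl_label X i) (kl_label Y i) (f.1 i) /\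
                  set_fun (kl_label Y i) (kl_label X i) (f.2 i)]].

Definition GH_S X Y : \bar R :=
  \big[mine/+oo]_(s : 'S_k) GH (relabel s X) Y.

Definition k_isomorphic X Y : Prop :=
  exists phi : X -> Y,
    [/\ bijective phi,
        forall x x', mdist (phi x) (phi x') = mdist x x' &
        forall i, phi @` kl_label X i = kl_label Y i].

End GromovHausdorff.

(* Main.v *)
(** Correspondences and pairs of maps with the same distortion bound can be
    exchanged, which gives (1); composing, transposing and relabeling
    correspondences gives the pseudometric axioms.  If [GH X Y = 0], take maps
    [f n i], [g n i] of distortion at most [2/(n+1)] and pass to limits along
    one nonprincipal ultrafilter on [nat]: the limits [phi i], [psi i] preserve
    distances, and closed labels are sent into labels.  Since distances between
    points with different labels are also preserved, the [phi i] agree on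
    overlaps and glue to one map; the limit of the codistortion bound,
    [d (x, psi y) = d (phi x, y)], makes the glued maps mutually inverse. *)
Require Import Defs.
From HB Require Import structures.
From mathcomp Require Import all_boot all_order all_algebra fingroup perm.
From mathcomp Require Import all_classical all_reals all_analysis.
From mathcomp Require Import lra.

Set Implicit Arguments.
Unset Strict Implicit.
Unset Printing Implicit Defensive.

Import Order.TTheory GRing.Theory Num.Theory.
Local Open Scope classical_set_scope.
Local Open Scope ring_scope.
Local Open Scope ereal_scope.

(** * Suprema and infima as pointwise bounds *)

Lemma correspondenceP (S T : Type) (A : set S) (B : set T) (C : set (S * T)) :
  correspondence A B C <->
  [/\ forall x y, C (x, y) -> A x /\ B y,
      forall x, A x -> exists y, C (x, y) &
      forall y, B y -> exists x, C (x, y)].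
Proof.
split=> [[CAB <- <-]|[CAB CA CB]].
  split=> [x y Cxy|_ [[x y] Cxy <-]|_ [[x y] Cxy <-]].
  - by split; exists (x, y).
  - by exists y.
  - by exists x.
split; first by move=> [x y] /CAB.
- apply/seteqP; split=> [_ [[x y] /CAB[Ax _] <-] //|x /CA[y Cxy]].
  by exists (x, y).
- apply/seteqP; split=> [_ [[x y] /CAB[_ By] <-] //|y /CB[x Cxy]].
  by exists (x, y).
Qed.

Lemma bigmaxe2_leP (R : realType) (k : nat) (F : 'I_k -> 'I_k -> \bar R) M :
  \big[maxe/-oo]_(i < k) \big[maxe/-oo]_(j < k) F i j <= M <->
  forall i j, F i j <= M.
Proof.
split=> [/bigmax_leP[_ FM] i j|FM].
  by have /bigmax_leP[_ ->] := FM i isT.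
apply/bigmax_leP; split=> [|i _]; first exact: leNye.
by apply/bigmax_leP; split=> [|j _]; [exact: leNye|exact: FM].
Qed.

Lemma le_half_ereal_inf (R : realType) (S : set (\bar R)) (a : \bar R) :
  a <= (2^-1)%:E * ereal_inf S <-> forall y, S y -> a <= (2^-1)%:E * y.
Proof.
have h : (0 < 2^-1 :> R)%R by rewrite invr_gt0.
split=> [aS y Sy|aS].
  by apply: (le_trans aS); apply: lee_wpmul2l; [rewrite lee_fin ltW|
     exact: ereal_inf_lbound].
by rewrite -lee_pdivrMl//; apply: le_ereal_inf_tmp => y /aS; rewrite lee_pdivrMl.
Qed.

(** Any upper bound [M] of the distortions is allowed, not only their maximum; estimates then need
    no nested suprema. *)
Definition corr_bound (R : realType) (k : nat) (X Y : klabeled R k)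
    (C : 'I_k -> set (X * Y)) (M : \bar R) : Prop :=
  (forall i, correspondence (kl_label X i) (kl_label Y i) (C i)) /\
  (forall i j x y x' y', C i (x, y) -> C j (x', y') ->
     `|mdist x x' - mdist y y'|%:E <= M).

Definition map_bound (R : realType) (k : nat) (X Y : klabeled R k)
    (f : 'I_k -> X -> Y) (g : 'I_k -> Y -> X) (M : \bar R) : Prop :=
  [/\ forall i x, kl_label X i x -> kl_label Y i (f i x),
      forall i y, kl_label Y i y -> kl_label X i (g i y),
      forall i j x x', kl_label X i x -> kl_label X j x' ->
        `|mdist x x' - mdist (f i x) (f j x')|%:E <= M,
      forall i j y y', kl_label Y i y -> kl_label Y j y' ->
        `|mdist y y' - mdist (g i y) (g j y')|%:E <= M &
      forall i j x y, kl_label X i x -> kl_label Y j y ->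
        `|mdist x (g j y) - mdist (f i x) y|%:E <= M].

(** The universal property of the infimum. Taking [a] to be the distance itself ([lexx]) turns every
    bounded family of correspondences into an upper bound for [GH]. *)
Lemma le_GHP (R : realType) (k : nat) (X Y : klabeled R k) (a : \bar R) :
  a <= GH X Y <->
  forall (C : 'I_k -> set (X * Y)) M, corr_bound C M -> a <= (2^-1)%:E * M.
Proof.
rewrite /GH le_half_ereal_inf; split=> [aC C M [CC CM]|aC _ [C CC <-]].
  apply: (le_trans (aC _ (ex_intro2 _ _ C CC erefl))).
  apply: lee_wpmul2l; first by rewrite lee_fin invr_ge0.
  apply/bigmaxe2_leP => i j; apply: ge_ereal_sup => _ [[x y] [[x' y'] [Cp Cq ->]]].
  exact: CM Cp Cq.
apply: (aC C); split=> // i j x y x' y' Cp Cq.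
have /bigmaxe2_leP/(_ i j) := lexx
  (\big[maxe/-oo]_(i < k) \big[maxe/-oo]_(j < k) dis_corr (C i) (C j)).
by apply: le_trans; apply: ereal_sup_ubound; exists (x, y), (x', y').
Qed.

Lemma le_GH_mapP (R : realType) (k : nat) (X Y : klabeled R k) (a : \bar R) :
  a <= GH_map X Y <->
  forall (f : 'I_k -> X -> Y) g M, map_bound f g M -> a <= (2^-1)%:E * M.
Proof.
rewrite /GH_map le_half_ereal_inf.
split=> [aC f g M [fXY gYX fM gM cM]|aC _ [[f g] /= fg <-]].
  have fg : forall i, set_fun (kl_label X i) (kl_label Y i) (f i) /\
                  set_fun (kl_label Y i) (kl_label X i) (g i).
    by move=> i; split=> ? ?; [exact: fXY|exact: gYX].
  apply: (le_trans (aC _ (ex_intro2 _ _ (f, g) fg erefl))).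
  apply: lee_wpmul2l; first by rewrite lee_fin invr_ge0.
  apply/bigmaxe2_leP => i j; rewrite !ge_max -!andbA /=.
  apply/and3P; split; apply: ge_ereal_sup => _ [x [x' [Ax Ax' ->]]].
  - exact: fM.
  - exact: gM.
  - exact: cM.
set M := (X in (2^-1)%:E * X).
have MP i j : [/\ dis_fun (kl_label X i) (kl_label X j) (f i) (f j) <= M,
    dis_fun (kl_label Y i) (kl_label Y j) (g i) (g j) <= M &
    codis_fun (kl_label X i) (kl_label Y j) (f i) (g j) <= M].
  have /bigmaxe2_leP/(_ i j) := lexx M.
  by rewrite !ge_max -!andbA => /and3P.
apply: (aC f g); split=> [i x|i y|i j x x' Ax Ax'|i j y y' Ay Ay'|i j x y Ax Ay].
- by have [+ _] := fg i; apply.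
- by have [_ +] := fg i; apply.
- have [+ _ _] := MP i j; apply: le_trans.
  by apply: ereal_sup_ubound; exists x, x'.
- have [_ + _] := MP i j; apply: le_trans.
  by apply: ereal_sup_ubound; exists y, y'.
- have [_ _] := MP i j; apply: le_trans.
  by apply: ereal_sup_ubound; exists x, y.
Qed.

(** * Correspondences versus pairs of maps *)

Lemma map_bound_corr (R : realType) (k : nat) (X Y : klabeled R k)
    (f : 'I_k -> X -> Y) (g : 'I_k -> Y -> X) M :
  map_bound f g M -> exists C : 'I_k -> set (X * Y), corr_bound C M.
Proof.
move=> [fXY gYX fM gM cM].
(* The graph of [f i] together with the transposed graph of [g i]. Two points of the same kind are
   compared by a distortion, two of different kinds by the codistortion. *)
exists (fun i => [set p | kl_label X i p.1 /\ p.2 = f i p.1 \/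
                          kl_label Y i p.2 /\ p.1 = g i p.2]).
split=> [i|i j x y x' y' /=].
  apply/correspondenceP; split=> [x y /= [[Xx ->]|[Yy ->]]|x Xx|y Yy].
  - by split=> //; exact: fXY.
  - by split=> //; exact: gYX.
  - by exists (f i x); left.
  - by exists (g i y); right.
move=> [[Xx ->]|[Yy ->]] [[Xx' ->]|[Yy' ->]].
- exact: fM.
- exact: cM.
- by rewrite metric_sym (metric_sym y); exact: cM.
- by rewrite distrC; exact: gM.
Qed.

(** Choose [f] and [g] inside the correspondences: [(x, f i x)] and [(g j y, y)] are then related
    pairs, so one bound covers distortions and codistortion. *)
Lemma corr_bound_map (R : realType) (k : nat) (X Y : klabeled R k)
    (C : 'I_k -> set (X * Y)) M :
  corr_bound C M ->
  exists (f : 'I_k -> X -> Y) (g : 'I_k -> Y -> X), map_bound f g M.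
Proof.
move=> [CC CM].
have /choice[f fP] : forall p : 'I_k * X, exists y,
    kl_label X p.1 p.2 -> C p.1 (p.2, y).
  move=> [i x]; have /correspondenceP[_ CX _] := CC i.
  have [/CX[y Cxy]|nXx] := pselect (kl_label X i x); first by exists y.
  by have [y _] := kl_nonempty Y i; exists y.
have /choice[g gP] : forall p : 'I_k * Y, exists x,
    kl_label Y p.1 p.2 -> C p.1 (x, p.2).
  move=> [i y]; have /correspondenceP[_ _ CY] := CC i.
  have [/CY[x Cxy]|nYy] := pselect (kl_label Y i y); first by exists x.
  by have [x _] := kl_nonempty X i; exists x.
exists (fun i x => f (i, x)), (fun i y => g (i, y)).
split=> [i x|i y|i j x x'|i j y y'|i j x y].
- by move/(fP (i, x)); have /correspondenceP[+ _ _] := CC i => /[apply] -[].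
- by move/(gP (i, y)); have /correspondenceP[+ _ _] := CC i => /[apply] -[].
- by move=> /(fP (i, x)) + /(fP (j, x')); exact: CM.
- by move=> /(gP (i, y)) + /(gP (j, y')); rewrite distrC; exact: CM.
- by move=> /(fP (i, x)) + /(gP (j, y)); exact: CM.
Qed.

Lemma GH_mapE (R : realType) (k : nat) (X Y : klabeled R k) :
  GH X Y = GH_map X Y.
Proof.
apply/eqP; rewrite eq_le; apply/andP; split.
  apply/le_GH_mapP => f g M /map_bound_corr[C].
  exact: (le_GHP X Y _).1.
apply/le_GHP => C M /corr_bound_map[f [g]].
exact: (le_GH_mapP X Y _).1.
Qed.

(** * Upper and lower bounds on [GH] *)

Lemma corr_bound_GH_le (R : realType) (k : nat) (X Y : klabeled R k)
    (C : 'I_k -> set (X * Y)) (e : R) :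
  corr_bound C (2 * e)%:E -> GH X Y <= e%:E.
Proof.
move=> /((le_GHP X Y _).1 (lexx _)).
by rewrite -EFinM mulrA mulVf ?mul1r// pnatr_eq0.
Qed.

(** If no family were bounded by [2 * e], every bound [M] would exceed [2 * e], and [e] would be a
    lower bound for [GH X Y]. *)
Lemma GH_lt_corr_bound (R : realType) (k : nat) (X Y : klabeled R k) (e : R) :
  GH X Y < e%:E ->
  exists C : 'I_k -> set (X * Y), corr_bound C (2 * e)%:E.
Proof.
apply: contraPP => /forallNP nC; apply/negP; rewrite -leNgt.
apply/le_GHP => C M [CC CM]; rewrite -lee_pdivrMl ?invr_gt0// invrK -EFinM.
have [//|/ltW Me] := leP (2 * e)%:E M.
have [] := nC C; split=> // i j x y x' y' Cp Cq.
exact: le_trans (CM _ _ _ _ _ _ Cp Cq) Me.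
Qed.

Lemma GH_lt_map_bound (R : realType) (k : nat) (X Y : klabeled R k) (e : R) :
  GH X Y < e%:E ->
  exists (f : 'I_k -> X -> Y) (g : 'I_k -> Y -> X), map_bound f g (2 * e)%:E.
Proof. by move=> /GH_lt_corr_bound[C /corr_bound_map]. Qed.

(** Any related pair compared with itself gives a nonnegative term. A first label must exist: the
    empty maximum is [-oo]. *)
Lemma GH_ge0 (R : realType) (k : nat) (X Y : klabeled R k) :
  (0 < k)%N -> 0 <= GH X Y.
Proof.
move=> k0; apply/le_GHP => C M [CC CM]; apply: mule_ge0.
  by rewrite lee_fin invr_ge0.
have /correspondenceP[_ CX _] := CC (Ordinal k0).
have [x /CX[y Cxy]] := kl_nonempty X (Ordinal k0).
by apply: le_trans (CM _ _ _ _ _ _ Cxy Cxy); rewrite lee_fin.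
Qed.

(** * Ultrafilter limits in compact spaces *)

(* Limits along an ultrafilter exist simultaneously for all sequences in a
   compact space, which replaces a diagonal extraction of subsequences. *)
Definition ulim (R : realType) (X : metricType R) (U : set_system nat)
    (u : nat -> X) (a : X) : Prop :=
  forall e : R, (0 < e)%R -> U [set n | (mdist a (u n) < e)%R].

Lemma ulim_cst (R : realType) (X : metricType R) (U : set_system nat) (a : X) :
  Filter U -> ulim U (fun=> a) a.
Proof. by move=> FU e e0; apply: filterE => n /=; rewrite mdistxx. Qed.

(** A cluster point is a limit: the ultrafilter contains either the indices landing in a given ball
    or their complement, and the complement contradicts clustering. *)
Lemma compact_ulim (R : realType) (X : metricType R) (U : set_system nat)
    (A : set X) (u : nat -> X) :
  UltraFilter U -> compact A -> (forall n, A (u n)) ->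
  exists2 a, A a & ulim U u a.
Proof.
move=> UU cA Au.
have [a [Aa ua]] := cA (u @ U) _ (@filterE _ U _ _ Au).
exists a => // e e0; have [//|UC] := in_ultra_setVsetC [set n | (mdist a (u n) < e)%R] UU.
have /(ua (~` [set y | (mdist a y < e)%R])) : nbhs a [set y | (mdist a y < e)%R].
  by rewrite -ballEmdist; exact: nbhsx_ballx.
by case=> // y [].
Qed.

Lemma nat_ultrafilter :
  exists U : set_system nat, UltraFilter U /\ \oo `<=` U.
Proof. by have [U [UU oU]] := @ultraFilterLemma _ \oo _; exists U. Qed.

Lemma compact_diameter (R : realType) (X : metricType R) :
  compact [set: X] -> exists D : R, forall x y : X, (mdist x y <= D)%R.
Proof.
move=> cX; have [[x0 _]|X0] := pselect (exists x0 : X, True); last first.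
  by exists 0%R => x; case: X0; exists x.
apply: contrapT => /forallNP nD.
(* Otherwise all points lie within [n] of [x0], and [n + n] bounds the diameter. The limit of [u]
   would then be infinitely far from [x0]. *)
have /choice[u uP] : forall n, exists x : X, (n%:R < mdist x0 x)%R.
  move=> n; apply: contrapT => /forallNP nx; apply: (nD (n%:R + n%:R)%R) => x y.
  apply: (le_trans (metric_triangle x x0 y)); rewrite (metric_sym x x0).
  by apply: lerD; rewrite leNgt; apply/negP; exact: nx.
have [U [UU oU]] := nat_ultrafilter.
have [//|a _ /(_ 1%R ltr01) ua] := @compact_ulim _ _ U [set: X] u UU cX.
have Ub : U [set n | (mdist x0 a + 1 < n%:R)%R].
  by apply: oU; exact: nbhs_infty_gtr.
have [n [/= h1 h2]] := filter_ex (filterI ua Ub).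
have := uP n; have := metric_triangle x0 a (u n); lra.
Qed.

(** * Pseudometric properties of [GH] *)

Lemma GH_fin_num (R : realType) (k : nat) (X Y : klabeled R k) :
  (0 < k)%N -> GH X Y \is a fin_num.
Proof.
move=> k0; rewrite ge0_fin_numE ?GH_ge0//.
have [DX DXP] := compact_diameter (kl_compact X).
have [DY DYP] := compact_diameter (kl_compact Y).
apply: (@le_lt_trans _ _ (2^-1 * (DX + DY))%:E); last by rewrite ltry.
(* Full products of labels are correspondences, and two distances bounded by [DX] and [DY] differ by
   at most [DX + DY]. *)
rewrite EFinM; apply: ((le_GHP X Y _).1 (lexx _)
  (fun i => kl_label X i `*` kl_label Y i)).
split=> [i|i j x y x' y' _ _].
  have [x Xx] := kl_nonempty X i; have [y Yy] := kl_nonempty Y i.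
  apply/correspondenceP; split=> [//|x' Xx'|y' Yy'].
    by exists y.
  by exists x.
rewrite lee_fin ler_norml; have := DXP x x'; have := DYP y y'.
have := mdist_ge0 x x'; have := mdist_ge0 y y'.
by move=> *; apply/andP; split; lra.
Qed.

Lemma GH_sym_le (R : realType) (k : nat) (X Y : klabeled R k) :
  GH Y X <= GH X Y.
Proof.
apply/le_GHP => C M [CC CM].
apply: ((le_GHP Y X _).1 (lexx _) (fun i => [set p | C i (p.2, p.1)])).
split=> [i|i j y x y' x' /= Cp Cq].
  have /correspondenceP[CXY CX CY] := CC i.
  by apply/correspondenceP; split=> [y x /= /CXY[]|y /CY|x /CX].
by rewrite distrC; exact: CM Cp Cq.
Qed.

Lemma GH_sym (R : realType) (k : nat) (X Y : klabeled R k) : GH X Y = GH Y X.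
Proof. by apply/eqP; rewrite eq_le !GH_sym_le. Qed.

Lemma GH_triangle (R : realType) (k : nat) (X Y Z : klabeled R k) :
  (0 < k)%N -> GH X Z <= GH X Y + GH Y Z.
Proof.
move=> k0; apply/lee_addgt0Pr => e e0.
have := GH_fin_num X Y k0; have := GH_fin_num Y Z k0.
have hlt (W W' : klabeled R k) : GH W W' \is a fin_num ->
    GH W W' < (fine (GH W W') + e / 2)%:E :> \bar R.
  by move=> h; rewrite -{1}(fineK h) lte_fin ltrDl divr_gt0.
move=> bf af; rewrite -(fineK af) -(fineK bf) -!EFinD.
have [C [CC CM]] := GH_lt_corr_bound (hlt _ _ af).
have [D [DD DM]] := GH_lt_corr_bound (hlt _ _ bf).
move: (fine (GH X Y)) (fine (GH Y Z)) CM DM => a b CM DM.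
(* Composed correspondences: the distortion bounds add, each factor contributing a slack of [e / 2]
   to the distance. *)
apply: (@corr_bound_GH_le _ _ _ _
  (fun i => [set p | exists y, C i (p.1, y) /\ D i (y, p.2)])).
split=> [i|i j x z x' z' /= [y [Cp Dp]] [y' [Cq Dq]]].
  have /correspondenceP[CXY CX CY] := CC i.
  have /correspondenceP[DXY DX DY] := DD i.
  apply/correspondenceP; split=> [x z /= [y [/CXY[? ?] /DXY[? ?]]] //|x|z].
    by move=> /CX[y Cp]; have [_ /DX[z Dp]] := CXY _ _ Cp; exists z, y.
  by move=> /DY[y Dp]; have [/CY[x Cp] _] := DXY _ _ Dp; exists x, y.
have := CM _ _ _ _ _ _ Cp Cq; have := DM _ _ _ _ _ _ Dp Dq.
rewrite !lee_fin !ler_norml => /andP[? ?] /andP[? ?].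
by apply/andP; split; lra.
Qed.

Lemma k_isomorphic_GH (R : realType) (k : nat) (X Y : klabeled R k) :
  (0 < k)%N -> k_isomorphic X Y -> GH X Y = 0.
Proof.
move=> k0 [phi [_ iso phiL]]; apply/eqP; rewrite eq_le GH_ge0// andbT.
apply: (@corr_bound_GH_le _ _ _ _
  (fun i => [set p | kl_label X i p.1 /\ p.2 = phi p.1])).
split=> [i|i j x y x' y' /= [_ ->] [_ ->]].
  rewrite -phiL; apply/correspondenceP; split=> [x y /= [Xx ->]|x Xx|_ [x Xx <-]].
  - by split=> //; exists x.
  - by exists (phi x).
  - by exists x.
by rewrite iso subrr normr0 mulr0.
Qed.

(** * Separation for closed labels *)

Lemma ulim_mdist_eq (R : realType) (X Y : metricType R) (U : set_system nat)
    (u u' : nat -> X) (v v' : nat -> Y) a a' b b' :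
  ProperFilter U -> \oo `<=` U ->
  ulim U u a -> ulim U u' a' -> ulim U v b -> ulim U v' b' ->
  (forall n, `|mdist (u n) (u' n) - mdist (v n) (v' n)| <= 2 * n.+1%:R^-1)%R ->
  mdist a a' = mdist b b'.
Proof.
move=> FU oU ua ua' vb vb' h.
apply/eqP; rewrite -subr_eq0 -normr_le0; apply/ler_addgt0Pr => e e0; rewrite add0r.
(* Four sixths of [e] pay for replacing the limits by the terms of index [n], two for the bound
   [2 * n.+1%:R^-1]. *)
have e6 : (0 < e / 6)%R by rewrite divr_gt0.
have Un : U [set n | (n.+1%:R^-1 < e / 6)%R].
  by apply: oU; exact: near_infty_natSinv_lt (PosNum e6).
have [n /= [[[[]]]]] := filter_ex (filterI (filterI (filterI (filterI
  (ua _ e6) (ua' _ e6)) (vb _ e6)) (vb' _ e6)) Un).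
rewrite /= => h1 h2 h3 h4 h5.
have := h n; rewrite !ler_norml => /andP[h6 h7].
have t1 := metric_triangle a (u n) a'; have t2 := metric_triangle (u n) (u' n) a'.
have t3 := metric_triangle (u n) a (u' n); have t4 := metric_triangle a a' (u' n).
have t5 := metric_triangle b (v n) b'; have t6 := metric_triangle (v n) (v' n) b'.
have t7 := metric_triangle (v n) b (v' n); have t8 := metric_triangle b b' (v' n).
move: t2 t3 t6 t7; rewrite (metric_sym (u' n) a') (metric_sym (u n) a).
rewrite (metric_sym (v' n) b') (metric_sym (v n) b) => t2 t3 t6 t7.
move: (n.+1%:R^-1)%R h5 h6 h7 => d h5 h6 h7.
by apply/andP; split; lra.
Qed.

Lemma GH_eq0_k_isomorphic (R : realType) (k : nat) (X Y : klabeled R k) :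
  closed_labels X -> closed_labels Y -> GH X Y = 0 -> k_isomorphic X Y.
Proof.
move=> cX cY XY0.
have /choice[F FP] : forall n, exists fg : ('I_k -> X -> Y) * ('I_k -> Y -> X),
    map_bound fg.1 fg.2 (2 * n.+1%:R^-1)%:E.
  move=> n; have [|f [g fgP]] := @GH_lt_map_bound _ _ X Y n.+1%:R^-1.
    by rewrite XY0 lte_fin invr_gt0.
  by exists (f, g).
have [U [UU oU]] := nat_ultrafilter.
have compact_label (Z : klabeled R k) i :
    closed_labels Z -> compact (kl_label Z i).
  by move=> cZ; exact: subclosed_compact (cZ i) (kl_compact Z) _.
(* Closed labels are compact, so the limit stays in the label; [y0] is a default value off the
   label. *)
have /choice[phi phiP] : forall p : 'I_k * X, exists b, kl_label X p.1 p.2 ->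
    kl_label Y p.1 b /\ ulim U (fun n => (F n).1 p.1 p.2) b.
  move=> [i x]; have [y0 _] := kl_nonempty Y i.
  have [Xx|nXx] := pselect (kl_label X i x); last by exists y0.
  have [|b Yb ub] := compact_ulim UU (compact_label Y i cY)
    (u := fun n => (F n).1 i x); last by exists b.
  by move=> n; have [+ _ _ _ _] := FP n; apply.
have /choice[psi psiP] : forall p : 'I_k * Y, exists a, kl_label Y p.1 p.2 ->
    kl_label X p.1 a /\ ulim U (fun n => (F n).2 p.1 p.2) a.
  move=> [i y]; have [x0 _] := kl_nonempty X i.
  have [Yy|nYy] := pselect (kl_label Y i y); last by exists x0.
  have [|a Xa ua] := compact_ulim UU (compact_label X i cX)
    (u := fun n => (F n).2 i y); last by exists a.
  by move=> n; have [_ + _ _ _] := FP n; apply.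
have phi_iso i j x x' : kl_label X i x -> kl_label X j x' ->
    mdist x x' = mdist (phi (i, x)) (phi (j, x')).
  move=> Xx Xx'; have [_ ux] := phiP (i, x) Xx; have [_ ux'] := phiP (j, x') Xx'.
  apply: (ulim_mdist_eq _ oU (ulim_cst x _) (ulim_cst x' _) ux ux') => n.
  by have [_ _ + _ _] := FP n; rewrite -lee_fin; apply.
have phi_psi i j x y : kl_label X i x -> kl_label Y j y ->
    mdist x (psi (j, y)) = mdist (phi (i, x)) y.
  move=> Xx Yy; have [_ ux] := phiP (i, x) Xx; have [_ uy] := psiP (j, y) Yy.
  apply: (ulim_mdist_eq _ oU (ulim_cst x _) uy ux (ulim_cst y _)) => n.
  by have [_ _ _ _ +] := FP n; rewrite -lee_fin; apply.
have label (Z : klabeled R k) z : exists i, kl_label Z i z.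
  by have : [set: Z] z by []; rewrite -(kl_cover Z) => -[i _ Zz]; exists i.
have /choice[lX lXP] := label X; have /choice[lY lYP] := label Y.
(* By [phi_iso] across two labels, both images of [x] are at distance [mdist x x], which is zero;
   the chosen label [lX x] is thus immaterial. *)
have phiE i x : kl_label X i x -> phi (lX x, x) = phi (i, x).
  by move=> Xx; apply: mdist_positivity; rewrite -phi_iso// mdistxx.
exists (fun x => phi (lX x, x)); split.
(* In [phi_psi], taking [y] to be the image of [x], or [x] the image of [y], makes one side
   vanish. *)
- exists (fun y => psi (lY y, y)) => [x|y]; apply: mdist_positivity.
    by rewrite metric_sym (phi_psi (lX x)) ?mdistxx.
  have [Xy _] := psiP (lY y, y) (lYP y).
  by rewrite -(phi_psi _ (lY y)) ?mdistxx.
- by move=> x x'; rewrite -phi_iso.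
- move=> i; apply/seteqP; split=> [_ [x Xx <-]|y Yy].
    by rewrite (phiE i)//; have [] := phiP (i, x) Xx.
  have [/= Xy _] := psiP (i, y) Yy; exists (psi (i, y)) => //=.
  by rewrite (phiE i)//; apply: mdist_positivity; rewrite -(phi_psi _ i)// mdistxx.
Qed.

(** * Relabeling and the minimum over permutations *)

Lemma eq_KLabeled (R : realType) (k : nat) (T : metricType R)
    (l l' : 'I_k -> set T) c c' n n' o o' :
  l = l' -> @KLabeled R k T l c n o = @KLabeled R k T l' c' n' o'.
Proof.
move=> ll'; case: _ / ll' n' o' => n' o'.
by congr KLabeled; exact: Prop_irrelevance.
Qed.

Lemma relabelM (R : realType) (k : nat) (s t : 'S_k) (X : klabeled R k) :
  relabel s (relabel t X) = relabel (s * t)%g X.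
Proof. by apply: eq_KLabeled; apply/funext => i /=; rewrite permM. Qed.

Lemma relabel1 (R : realType) (k : nat) (X : klabeled R k) :
  relabel 1%g X = X.
Proof.
by case: X => T l c n o; apply: eq_KLabeled; apply/funext => i /=; rewrite perm1.
Qed.

(** Reindexing a family of correspondences by [s] keeps its bound. *)
Lemma GH_relabel_le (R : realType) (k : nat) (s : 'S_k) (X Y : klabeled R k) :
  GH (relabel s X) (relabel s Y) <= GH X Y.
Proof.
apply/le_GHP => C M [CC CM].
apply: ((le_GHP (relabel s X) (relabel s Y) _).1 (lexx _) (C \o s)).
by split=> [i|i j x y x' y']; [exact: CC|exact: CM].
Qed.

Lemma GH_S_le (R : realType) (k : nat) (s : 'S_k) (X Y : klabeled R k) :
  GH_S X Y <= GH (relabel s X) Y.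
Proof. exact: bigmin_le_cond. Qed.

Lemma GH_S_attained (R : realType) (k : nat) (X Y : klabeled R k) :
  exists s : 'S_k, GH_S X Y = GH (relabel s X) Y.
Proof.
rewrite /GH_S (@bigmin_eq_arg _ _ _ _ 1%g)//; first by eexists.
by move=> s _; exact: leey.
Qed.

Lemma GH_S_sym_le (R : realType) (k : nat) (X Y : klabeled R k) :
  GH_S Y X <= GH_S X Y.
Proof.
have [s ->] := GH_S_attained X Y; apply: (le_trans (GH_S_le s^-1%g Y X)).
(* Writing [X] as [relabel s^-1 (relabel s X)] puts the same relabeling on both arguments. *)
rewrite GH_sym -{1}(relabel1 X) -(mulVg s) -relabelM.
exact: GH_relabel_le.
Qed.

Lemma GH_S_triangle (R : realType) (k : nat) (X Y Z : klabeled R k) :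
  (0 < k)%N -> GH_S X Z <= GH_S X Y + GH_S Y Z.
Proof.
move=> k0; have [s ->] := GH_S_attained X Y; have [t ->] := GH_S_attained Y Z.
(* With [s] optimal for [X, Y] and [t] for [Y, Z], applying [t] to the first pair makes
   [relabel t Y] the common middle space. *)
apply: (le_trans (GH_S_le (t * s)%g X Z)); rewrite -relabelM.
apply: (le_trans (GH_triangle _ (relabel t Y) _ k0)).
by apply: leeD => //; exact: GH_relabel_le.
Qed.

Theorem corollary2p4p2 (R : realType) (k : nat) (hk : (0 < k)%N) :
  (forall X Y : klabeled R k,
     GH_S X Y = \big[mine/+oo]_(s : 'S_k) GH_map (relabel s X) Y) /\
  ((forall X Y : klabeled R k, 0 <= GH_S X Y) /\
   (forall X Y : klabeled R k, GH_S X Y \is a fin_num) /\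
   (forall X Y : klabeled R k, GH_S X Y = GH_S Y X) /\
   (forall X Y Z : klabeled R k, GH_S X Z <= GH_S X Y + GH_S Y Z) /\
   (forall X Y : klabeled R k,
      (exists s : 'S_k, k_isomorphic (relabel s X) Y) -> GH_S X Y = 0) /\
   (forall X Y : klabeled R k, closed_labels X -> closed_labels Y ->
      (GH_S X Y = 0 <-> exists s : 'S_k, k_isomorphic (relabel s X) Y))).
Proof.
have S_ge0 (X Y : klabeled R k) : 0 <= GH_S X Y.
  by have [s ->] := GH_S_attained X Y; exact: GH_ge0.
have iso_S0 (X Y : klabeled R k) :
    (exists s : 'S_k, k_isomorphic (relabel s X) Y) -> GH_S X Y = 0.
  move=> [s iso]; apply/eqP; rewrite eq_le S_ge0 andbT.
  by rewrite -(k_isomorphic_GH hk iso); exact: GH_S_le.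
split; first by move=> X Y; apply: eq_bigr => s _; exact: GH_mapE.
do 5?split=> //.
- by move=> X Y; have [s ->] := GH_S_attained X Y; exact: GH_fin_num.
- by move=> X Y; apply/eqP; rewrite eq_le !GH_S_sym_le.
- by move=> X Y Z; exact: GH_S_triangle.
- move=> X Y cX cY; split; last exact: iso_S0.
  have [s ->] := GH_S_attained X Y => XY0; exists s.
  by apply: GH_eq0_k_isomorphic => // i; exact: cX.
Qed.
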